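(* Let $(\mathcal{H}_1,\mathfrak{A}_0)$ and $(\mathcal{H}_2,\mathfrak{B}_0)$ be unital Hilbert quasi *-algebras with inner products $\langle\cdot|\cdot\rangle_1$ and $\langle\cdot|\cdot\rangle_2$. Equip the algebraic tensor product $\mathcal{H}_1\otimes\mathcal{H}_2$, and its subspace $\mathfrak{A}_0\otimes\mathfrak{B}_0$, with the inner product $$\Big\langle \sum_{i=1}^n\xi_i\otimes\eta_i\,\Big|\,\sum_{j=1}^m\xi'_j\otimes\eta'_j\Big\rangle=\sum_{i=1}^n\sum_{j=1}^m\langle\xi_i|\xi_j'\rangle_1\,\langle\eta_i|\eta_j'\rangle_2 ,$$ and denote by $\widehat{\otimes}^h$ completion with respect to the associated norm $\|\cdot\|_h$. Then the completion $\mathfrak{A}_0\widehat{\otimes}^h\mathfrak{B}_0\cong\mathcal{H}_1\widehat{\otimes}^h\mathcal{H}_2$ of the tensor product *-algebra $\mathfrak{A}_0\otimes\mathfrak{B}_0$ (the isomorphism being the one induced by the inclusion $\mathfrak{A}_0\otimes\mathfrak{B}_0\subseteq\mathcal{H}_1\otimes\mathcal{H}_2$) is a unital Hilbert quasi *-algebra; that is, $(\mathcal{H}_1\widehat{\otimes}^h\mathcal{H}_2,\mathfrak{A}_0\otimes\mathfrak{B}_0)$ is a unital Hilbert quasi *-algebra.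
   Context: All vector spaces are complex, and inner products are linear in the first variable. Quasi *-algebra: a pair $(\mathfrak{A},\mathfrak{A}_0)$ consisting of a vector space $\mathfrak{A}$ and a *-algebra $\mathfrak{A}_0$ contained in $\mathfrak{A}$ as a subspace such that (i) $\mathfrak{A}$ carries an involution $a\mapsto a^*$ extending that of $\mathfrak{A}_0$; (ii) $\mathfrak{A}$ is a bimodule over $\mathfrak{A}_0$ and the module multiplications extend the multiplication of $\mathfrak{A}_0$, in particular $(xa)y=x(ay)$ and $a(xy)=(ax)y$ for all $a\in\mathfrak{A}$, $x,y\in\mathfrak{A}_0$; (iii) $(ax)^*=x^*a^*$ for all $a\in\mathfrak{A}$, $x\in\mathfrak{A}_0$. It is unital if there is $\mathbb{1}\in\mathfrak{A}_0$ with $a\mathbb{1}=a=\mathbb{1}a$ for all $a\in\mathfrak{A}$. Hilbert quasi *-algebra: let $\mathfrak{A}_0$ be a *-algebra which is also a pre-Hilbert space with inner product $\langle\cdot|\cdot\rangle$ such that (1) for each $x\in\mathfrak{A}_0$ the map $y\in\mathfrak{A}_0\mapsto xy\in\mathfrak{A}_0$ is continuous for the norm defined by the inner product; (2) $\langle xy|z\rangle=\langle y|x^*z\rangle$ for all $x,y,z\in\mathfrak{A}_0$; (3) $\langle x|y\rangle=\langle y^*|x^*\rangle$ for all $x,y\in\mathfrak{A}_0$; (4) $\mathfrak{A}_0^2=\{xy:x,y\in\mathfrak{A}_0\}$ is total in $\mathfrak{A}_0$. If $\mathcal{H}$ is the Hilbert space completion of $\mathfrak{A}_0$, then $(\mathcal{H},\mathfrak{A}_0)$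 is called a Hilbert quasi *-algebra. The involution of $\mathfrak{A}_0$ and left and right multiplications by elements of $\mathfrak{A}_0$ are extended to $\mathcal{H}$ by continuity, making $(\mathcal{H},\mathfrak{A}_0)$ a quasi *-algebra. Tensor product *-algebra: $\mathfrak{A}_0\otimes\mathfrak{B}_0$ is the algebraic tensor product with product $\big(\sum_i x_i\otimes y_i\big)\big(\sum_j x'_j\otimes y'_j\big)=\sum_{i,j}x_ix'_j\otimes y_iy'_j$ and involution $\big(\sum_i x_i\otimes y_i\big)^*=\sum_i x_i^*\otimes y_i^*$; it is regarded as a subspace of $\mathcal{H}_1\otimes\mathcal{H}_2$, on which the module actions and involution are defined by $(x\otimes y)(\xi\otimes\eta)=x\xi\otimes y\eta$, $(\xi\otimes\eta)(x\otimes y)=\xi x\otimes\eta y$, $(\xi\otimes\eta)^*=\xi^*\otimes\eta^*$. *)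

(* Defs.v *)
From HB Require Import structures.
From mathcomp Require Import all_boot all_order all_algebra sesquilinear.
From mathcomp Require Import generic_quotient complex.
From mathcomp Require Import boolp classical_sets reals topology normedtype.

Set Implicit Arguments.
Unset Strict Implicit.
Unset Printing Implicit Defensive.

Import Order.TTheory GRing.Theory Num.Theory.
Import numFieldNormedType.Exports.

Local Open Scope quotient_scope.
Local Open Scope classical_set_scope.
Local Open Scope ring_scope.

Section AlgebraicTensorProduct.
Variables (F : comNzRingType) (U V : lmodType F).

Definition pair_sum (W : lmodType F) (b : U -> V -> W) (s : seq (U * V)) : W :=
  \sum_(p <- s) b p.1 p.2.

(* A list of pairs stands for the finite sum of the elementary tensors u ⊗ v.
   Two lists are identified when no bilinear map separates them, which is the
   quotient of the free module by the bilinearity relations. The universal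
   property is given by tensor_liftp and tensor_lift_uniq below. *)
Definition tensor_eqv (s t : seq (U * V)) : bool :=
  `[< forall (W : lmodType F) (b : {bilinear U -> V -> W}),
        pair_sum b s = pair_sum b t >].

Lemma tensor_eqvP s t :
  reflect (forall (W : lmodType F) (b : {bilinear U -> V -> W}),
             pair_sum b s = pair_sum b t) (tensor_eqv s t).
Proof. exact: asboolP. Qed.

Lemma tensor_eqv_equiv : equiv_class_of tensor_eqv.
Proof.
split=> [s|s t|t s u].
- exact/tensor_eqvP.
- by apply/tensor_eqvP/tensor_eqvP => H W b.
- move=> /tensor_eqvP H1 /tensor_eqvP H2; apply/tensor_eqvP => W b.
  by rewrite H1.
Qed.

Canonical tensor_equiv := EquivRelPack tensor_eqv_equiv.

Definition tensor := {eq_quot tensor_equiv}.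

HB.instance Definition _ := Choice.on tensor.

Definition tensor_of (s : seq (U * V)) : tensor := \pi_{eq_quot tensor_equiv} s.
Definition tensor_repr (t : tensor) : seq (U * V) :=
  repr (t : {eq_quot tensor_equiv}).

Lemma tensor_reprK t : tensor_of (tensor_repr t) = t.
Proof. exact: reprK. Qed.

Lemma tensor_ofP s t :
  (forall (W : lmodType F) (b : {bilinear U -> V -> W}),
      pair_sum b s = pair_sum b t) -> tensor_of s = tensor_of t.
Proof. by move=> H; apply/eqmodP/tensor_eqvP. Qed.

Definition tensor_lift (W : lmodType F) (b : U -> V -> W) (t : tensor) : W :=
  pair_sum b (tensor_repr t).

Lemma tensor_lift_of (W : lmodType F) (b : {bilinear U -> V -> W}) s :
  tensor_lift b (tensor_of s) = pair_sum b s.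
Proof.
by move: W b; apply/tensor_eqvP; apply/eqmodP; exact: tensor_reprK.
Qed.

Lemma tensor_lift_inj (s t : tensor) :
  (forall (W : lmodType F) (b : {bilinear U -> V -> W}),
      tensor_lift b s = tensor_lift b t) -> s = t.
Proof.
move=> H; rewrite -[s]tensor_reprK -[t]tensor_reprK; exact: tensor_ofP.
Qed.

Definition tensor_zero : tensor := tensor_of [::].
Definition tensor_add (s t : tensor) : tensor :=
  tensor_of (tensor_repr s ++ tensor_repr t).
Definition tensor_scale (a : F) (s : tensor) : tensor :=
  tensor_of [seq (a *: p.1, p.2) | p <- tensor_repr s].
Definition tensor_opp (s : tensor) : tensor := tensor_scale (-1) s.

Lemma tensor_lift_zero (W : lmodType F) (b : {bilinear U -> V -> W}) :
  tensor_lift b tensor_zero = 0.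
Proof. by rewrite tensor_lift_of /pair_sum big_nil. Qed.

Lemma tensor_lift_add (W : lmodType F) (b : {bilinear U -> V -> W}) s t :
  tensor_lift b (tensor_add s t) = tensor_lift b s + tensor_lift b t.
Proof. by rewrite tensor_lift_of /pair_sum big_cat. Qed.

Lemma tensor_lift_scale (W : lmodType F) (b : {bilinear U -> V -> W}) a s :
  tensor_lift b (tensor_scale a s) = a *: tensor_lift b s.
Proof.
rewrite tensor_lift_of /pair_sum big_map scaler_sumr.
by apply: eq_bigr => p _ /=; rewrite linearZl_LR.
Qed.

Let tensor_liftE := (tensor_lift_zero, tensor_lift_add, tensor_lift_scale).

Lemma tensor_addA : associative tensor_add.
Proof. by move=> s t u; apply: tensor_lift_inj => W b; rewrite !tensor_liftE addrA. Qed.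
Lemma tensor_addC : commutative tensor_add.
Proof. by move=> s t; apply: tensor_lift_inj => W b; rewrite !tensor_liftE addrC. Qed.
Lemma tensor_add0 : left_id tensor_zero tensor_add.
Proof. by move=> s; apply: tensor_lift_inj => W b; rewrite !tensor_liftE add0r. Qed.
Lemma tensor_addN : left_inverse tensor_zero tensor_opp tensor_add.
Proof.
move=> s; apply: tensor_lift_inj => W b.
by rewrite /tensor_opp !tensor_liftE scaleN1r addNr.
Qed.

HB.instance Definition _ := GRing.isZmodule.Build tensor
  tensor_addA tensor_addC tensor_add0 tensor_addN.

Lemma tensor_scaleA a b s : tensor_scale a (tensor_scale b s) = tensor_scale (a * b) s.
Proof. by apply: tensor_lift_inj => W f; rewrite !tensor_liftE scalerA. Qed.
Lemma tensor_scale1 : left_id 1 tensor_scale.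
Proof. by move=> s; apply: tensor_lift_inj => W f; rewrite !tensor_liftE scale1r. Qed.
Lemma tensor_scaleDr : right_distributive tensor_scale +%R.
Proof. by move=> a s t; apply: tensor_lift_inj => W f; rewrite !tensor_liftE scalerDr. Qed.
Lemma tensor_scaleDl s : {morph tensor_scale^~ s : a b / a + b}.
Proof. by move=> a b; apply: tensor_lift_inj => W f; rewrite !tensor_liftE scalerDl. Qed.

HB.instance Definition _ := GRing.Zmodule_isLmodule.Build F tensor
  tensor_scaleA tensor_scale1 tensor_scaleDr tensor_scaleDl.

Lemma tensor_lift_linear (W : lmodType F) (b : {bilinear U -> V -> W}) :
  linear (tensor_lift b).
Proof. by move=> a s t; rewrite tensor_lift_add tensor_lift_scale. Qed.

HB.instance Definition _ (W : lmodType F) (b : {bilinear U -> V -> W}) :=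
  GRing.isLinear.Build F tensor W _ (tensor_lift b) (tensor_lift_linear b).

Definition ptensor (u : U) (v : V) : tensor := tensor_of [:: (u, v)].

Lemma tensor_liftp (W : lmodType F) (b : {bilinear U -> V -> W}) u v :
  tensor_lift b (ptensor u v) = b u v.
Proof. by rewrite tensor_lift_of /pair_sum big_seq1. Qed.

Lemma ptensor_bilinear :
  bilinear_for (GRing.Scale.Law.clone _ _ ( *:%R : F -> tensor -> tensor) _)
    (GRing.Scale.Law.clone _ _ ( *:%R : F -> tensor -> tensor) _) ptensor.
Proof.
split=> [v|u] a x y; apply: tensor_lift_inj => W b; rewrite linearP /= !tensor_liftp.
  by rewrite linearPl.
by rewrite linearPr.
Qed.

HB.instance Definition _ :=
  bilinear_isBilinear.Build F U V tensor _ _ ptensor ptensor_bilinear.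

Lemma tensor_ofE s : tensor_of s = \sum_(p <- s) ptensor p.1 p.2.
Proof.
apply: tensor_lift_inj => W b; rewrite tensor_lift_of linear_sum /=.
by apply: eq_bigr => p _; rewrite tensor_liftp.
Qed.

Lemma tensor_sumE t : exists s : seq (U * V), t = \sum_(p <- s) ptensor p.1 p.2.
Proof. by exists (tensor_repr t); rewrite -tensor_ofE tensor_reprK. Qed.

Lemma tensor_ind (P : tensor -> Prop) :
  P 0 -> (forall s t, P s -> P t -> P (s + t)) ->
  (forall u v, P (ptensor u v)) -> forall t, P t.
Proof.
move=> P0 PD Pp t; have [s ->] := tensor_sumE t.
by elim/big_ind: _ => // p _.
Qed.

Lemma tensor_lift_uniq (W : lmodType F) (f g : {linear tensor -> W}) :
  (forall u v, f (ptensor u v) = g (ptensor u v)) -> f =1 g.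
Proof.
move=> fg t; have [s ->] := tensor_sumE t.
by rewrite !linear_sum; apply: eq_bigr.
Qed.

End AlgebraicTensorProduct.


Section TensorMap.
Variables (F : comNzRingType) (U V U' V' : lmodType F).
Variables (f : {linear U -> U'}) (g : {linear V -> V'}).

Definition tensor_map_form (u : U) (v : V) : tensor U' V' := ptensor (f u) (g v).

Lemma tensor_map_form_bilinear : bilinear_for *:%R *:%R tensor_map_form.
Proof.
by split=> [v|u] a x y; rewrite /tensor_map_form linearP ?linearPl ?linearPr.
Qed.
HB.instance Definition _ := bilinear_isBilinear.Build F U V (tensor U' V') _ _
  tensor_map_form tensor_map_form_bilinear.

Definition tensor_map : tensor U V -> tensor U' V' := tensor_lift tensor_map_form.
HB.instance Definition _ := GRing.Linear.on tensor_map.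

Lemma tensor_mapp u v : tensor_map (ptensor u v) = ptensor (f u) (g v).
Proof. exact: tensor_liftp. Qed.

End TensorMap.

(* {dot V for conj} is a positive definite hermitian form, linear in the first
   variable and conjugate-linear in the second. Norms take their values in the
   scalar field C, as required by normedModType. *)
HB.mixin Record NormedModule_isPreHilbert (C : numClosedFieldType) V
    & NormedModule C V := {
  ip : {dot V for @Num.conj C};
  ip_norm : forall x : V, `|x| ^+ 2 = ip x x
}.
#[short(type="preHilbertType")]
HB.structure Definition PreHilbert (C : numClosedFieldType) :=
  {V of NormedModule C V & NormedModule_isPreHilbert C V}.
#[short(type="hilbertType")]
HB.structure Definition Hilbert (C : numClosedFieldType) :=
  {V of CompleteNormedModule C V & PreHilbert C V}.

Section InnerProductTheory.
Variables (C : numClosedFieldType) (V : preHilbertType C).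
Implicit Types x y z : V.

Lemma ipDl x y z : ip (x + y) z = ip x z + ip y z.
Proof. by rewrite linearDl. Qed.
Lemma ipDr x y z : ip x (y + z) = ip x y + ip x z.
Proof. by rewrite linearDr. Qed.
Lemma ipZl a x z : ip (a *: x) z = a * ip x z.
Proof. by rewrite linearZl_LR. Qed.
Lemma ipZr a x z : ip x (a *: z) = a^* * ip x z.
Proof. by rewrite linearZr_LR. Qed.
Lemma ipC x y : ip x y = (ip y x)^*.
Proof. by rewrite (hermC ip) expr0 mul1r. Qed.

End InnerProductTheory.

Section TensorInnerProduct.
Variables (C : numClosedFieldType) (U V : preHilbertType C).

Definition tensor_ip_form (u' : U) (v' : V) (u : U) (v : V) : C^o :=
  ip u u' * ip v v'.

Lemma tensor_ip_form_bilinear u' v' :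
  bilinear_for *:%R *:%R (tensor_ip_form u' v').
Proof.
split=> [v|u] a x y; rewrite /tensor_ip_form ipDl ipZl.
  by rewrite mulrDl -mulrA.
by rewrite mulrDr mulrCA.
Qed.
HB.instance Definition _ u' v' := bilinear_isBilinear.Build C U V C^o _ _
  (tensor_ip_form u' v') (tensor_ip_form_bilinear u' v').

Definition tensor_ip_form2 (t : tensor U V) (u : U) (v : V) : C^o :=
  (tensor_lift (tensor_ip_form u v) t)^*.

Lemma tensor_ip_form2E s u v :
  tensor_ip_form2 (tensor_of s) u v =
  \sum_(p <- s) ip u p.1 * ip v p.2.
Proof.
rewrite /tensor_ip_form2 tensor_lift_of /pair_sum rmorph_sum.
by apply: eq_bigr => p _; rewrite rmorphM /= -!ipC.
Qed.

Lemma tensor_ip_form2_bilinear t :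
  bilinear_for *:%R *:%R (tensor_ip_form2 t).
Proof.
split=> [v|u] a x y; rewrite -(tensor_reprK t) !tensor_ip_form2E.
  rewrite [X in _ = X + _]mulr_sumr -big_split; apply: eq_bigr => p _ /=.
  by rewrite ipDl ipZl mulrDl -mulrA.
rewrite [X in _ = X + _]mulr_sumr -big_split; apply: eq_bigr => p _ /=.
by rewrite ipDl ipZl mulrDr mulrCA.
Qed.
HB.instance Definition _ t := bilinear_isBilinear.Build C U V C^o _ _
  (tensor_ip_form2 t) (tensor_ip_form2_bilinear t).

Definition tensor_ip (t t' : tensor U V) : C :=
  tensor_lift (tensor_ip_form2 t') t.

Lemma tensor_ip_sum s s' :
  tensor_ip (tensor_of s) (tensor_of s') =
  \sum_(p <- s) \sum_(q <- s') ip p.1 q.1 * ip p.2 q.2.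
Proof.
rewrite /tensor_ip tensor_lift_of; apply: eq_bigr => p _.
exact: tensor_ip_form2E.
Qed.

Lemma tensor_ip_conj s t : tensor_ip s t = (tensor_ip t s)^*.
Proof.
rewrite -(tensor_reprK s) -(tensor_reprK t) !tensor_ip_sum exchange_big.
rewrite rmorph_sum; apply: eq_bigr => p _; rewrite rmorph_sum.
by apply: eq_bigr => q _; rewrite rmorphM /= -!ipC.
Qed.

Lemma tensor_ip_linearl t a x y :
  tensor_ip (a *: x + y) t = a * tensor_ip x t + tensor_ip y t.
Proof. exact: (linearP (tensor_lift (tensor_ip_form2 t))). Qed.

Lemma tensor_ip_bilinear :
  bilinear_for *%R (@Num.conj C \; *%R) tensor_ip.
Proof.
split=> [t|t] a x y; first exact: tensor_ip_linearl.
rewrite tensor_ip_conj tensor_ip_linearl rmorphD rmorphM /=.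
by rewrite -!tensor_ip_conj.
Qed.

Lemma tensor_ip_hermitian s t :
  tensor_ip s t = (-1) ^+ false * (tensor_ip t s)^*.
Proof. by rewrite expr0 mul1r -tensor_ip_conj. Qed.


HB.instance Definition _ := bilinear_isBilinear.Build C _ _ _ _ _
  tensor_ip tensor_ip_bilinear.
HB.instance Definition _ := isHermitianSesquilinear.Build C _ _ _
  tensor_ip tensor_ip_hermitian.

(* Gram-Schmidt on the left factors, used for positive definiteness. *)
Lemma tensor_orthogonalize (s : seq (U * V)) :
  exists n (e : 'I_n -> U) (v : 'I_n -> V),
    (forall i, ip (e i) (e i) = 1) /\
    (forall i j, i != j -> ip (e i) (e j) = 0) /\
    tensor_of s = \sum_(i < n) ptensor (e i) (v i).
Proof.
elim: s => [|[x y] s [n [e [v [e1 [eo es]]]]]].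
  exists 0%N, (fun=> 0), (fun=> 0); split; first by case.
  by split; [case|rewrite big_ord0 tensor_ofE big_nil].
pose p := x - \sum_(i < n) ip x (e i) *: e i.
have pe i : ip p (e i) = 0.
  rewrite /p linearBl /= linear_sumlz (bigD1 i) //= big1 => [|j ji].
    by rewrite ipZl e1 mulr1 addr0 subrr.
  by rewrite ipZl eo ?mulr0.
have xy : tensor_of ((x, y) :: s) = ptensor p y +
    \sum_(i < n) ptensor (e i) (v i + ip x (e i) *: y).
  rewrite tensor_ofE big_cons -tensor_ofE es /=.
  rewrite -[in LHS](subrK (\sum_(i < n) ip x (e i) *: e i) x) -/p.
  rewrite linearDl /= linear_sumlz -addrA -big_split /=; congr (_ + _).
  apply: eq_bigr => i _.
  by rewrite linearDr /= linearZl_LR linearZr_LR /= addrC.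
have [p0|p0] := eqVneq p 0.
  exists n, e, (fun i => v i + ip x (e i) *: y); split=> //; split=> //.
  by rewrite xy p0 linear0l add0r.
have np : `|p| != 0 by rewrite normr_eq0.
pose e' (i : 'I_n.+1) := oapp e (`|p|^-1 *: p) (unlift ord0 i).
pose v' (i : 'I_n.+1) :=
  oapp (fun i => v i + ip x (e i) *: y) (`|p| *: y) (unlift ord0 i).
have pR : (`|p|^-1)^* = `|p|^-1 :> C by rewrite geC0_conj // invr_ge0.
exists n.+1, e', v'; split; [|split].
- move=> i; rewrite /e'; case: unliftP => [j _|_] /=; first exact: e1.
  by rewrite ipZl ipZr pR -ip_norm expr2 mulrA mulrACA mulVf // mulr1.
- move=> i j; rewrite /e'.
  case: unliftP => [i' ->|->]; case: unliftP => [j' ->|->] /=.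
  + by rewrite (inj_eq lift_inj); exact: eo.
  + by rewrite ipC ipZl pe mulr0 rmorph0.
  + by rewrite ipZl pe mulr0.
  + by rewrite ?eqxx.
rewrite xy big_ord_recl /e' /v' unlift_none /=; congr (_ + _).
  by rewrite linearZl_LR linearZr_LR /= scalerA mulVf // scale1r.
by apply: eq_bigr => i _; rewrite liftK.
Qed.

Lemma tensor_ip_gt0 (t : tensor U V) : t != 0 -> 0 < tensor_ip t t.
Proof.
have [n [e [v [e1 [eo]]]]] := tensor_orthogonalize (tensor_repr t).
rewrite tensor_reprK => tE t0.
have ipt : tensor_ip t t = \sum_(i < n) `|v i| ^+ 2.
  have -> : t = tensor_of [seq (e i, v i) | i <- index_enum 'I_n].
    by rewrite tensor_ofE big_map.
  rewrite tensor_ip_sum big_map; apply: eq_bigr => i _; rewrite big_map.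
  rewrite (bigD1 i) //= e1 mul1r big1 ?addr0 ?ip_norm // => j ji.
  by rewrite eo ?mul0r // eq_sym.
rewrite lt_def ipt sumr_ge0 => [|i _]; last by rewrite exprn_ge0.
rewrite andbT; apply: contra t0 => /eqP v0.
rewrite tE big1 // => i _.
have : `|v i| ^+ 2 = 0.
  by apply: (psumr_eq0P _ v0) => // j _; rewrite exprn_ge0.
by move=> /eqP; rewrite expf_eq0 /= normr_eq0 => /eqP ->; rewrite linear0r.
Qed.
HB.instance Definition _ := isDotProduct.Build C _ tensor_ip tensor_ip_gt0.

Definition tensor_norm (t : tensor U V) : C := sqrtC (tensor_ip t t).

Lemma tensor_normK t : tensor_norm t ^+ 2 = tensor_ip t t.
Proof. exact: sqrtCK. Qed.

Lemma tensor_norm_ge0 t : 0 <= tensor_norm t.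
Proof. exact: sqrt_dnorm_ge0. Qed.

Lemma tensor_CauchySchwarz s t :
  `|tensor_ip s t| <= tensor_norm s * tensor_norm t.
Proof.
have [->|t0] := eqVneq t 0.
  by rewrite linear0r normr0 mulr_ge0 ?tensor_norm_ge0.
have tt0 := tensor_ip_gt0 t0.
rewrite -(@ler_pXn2r _ 2) ?nnegrE ?mulr_ge0 ?tensor_norm_ge0 //.
rewrite exprMn !tensor_normK.
pose a := tensor_ip s t / tensor_ip t t.
have stE : tensor_ip s t = a * tensor_ip t t by rewrite divfK // gt_eqF.
pose r := `|a| ^+ 2 * tensor_ip t t.
have rC : r^* = r by apply/geC0_conj/mulr_ge0; rewrite ?exprn_ge0 // ltW.
have : 0 <= tensor_ip (s - a *: t) (s - a *: t) by exact: dnorm_ge0.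
rewrite dnormB dnormZ linearZr_LR /= stE.
rewrite [a^* * _](_ : _ = r); last by rewrite mulrA mulrC /r normCK [a * _]mulrC mulrC.
rewrite -/r rC opprD addrA addrK subr_ge0 => rs.
rewrite normrM exprMn (ger0_norm (ltW tt0)) expr2 mulrA -/r.
by rewrite ler_pM2r.
Qed.

Lemma tensor_normD s t : tensor_norm (s + t) <= tensor_norm s + tensor_norm t.
Proof.
rewrite -(@ler_pXn2r _ 2) ?nnegrE ?addr_ge0 ?tensor_norm_ge0 //.
rewrite sqrrD !tensor_normK dnormD addrAC lerD2r lerD2l.
have dR : tensor_ip s t + (tensor_ip s t)^* \is Num.real.
  by apply/CrealP; rewrite rmorphD /= conjCK addrC.
apply: le_trans (real_ler_norm dR) _; apply: le_trans (ler_normD _ _) _.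
by rewrite norm_conjC mulr2n lerD // tensor_CauchySchwarz.
Qed.

Lemma tensor_normZ a t : tensor_norm (a *: t) = `|a| * tensor_norm t.
Proof.
rewrite /tensor_norm dnormZ rootCMl ?exprn_ge0 //.
by rewrite sqrCK.
Qed.

Lemma tensor_norm_eq0 t : tensor_norm t = 0 -> t = 0.
Proof. by move=> /eqP; rewrite sqrt_dnorm_eq0 => /eqP. Qed.

End TensorInnerProduct.

HB.instance Definition _ (C : numClosedFieldType) (U V : preHilbertType C) :=
  Lmodule_isNormed.Build C (tensor U V) (@tensor_normD C U V)
    (@tensor_normZ C U V) (@tensor_norm_eq0 C U V).

HB.instance Definition _ (C : numClosedFieldType) (U V : preHilbertType C) :=
  NormedModule_isPreHilbert.Build C (tensor U V) (@tensor_normK C U V).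


(* The product is not assumed to have a unit, hence no use of algType. *)
HB.mixin Record Lmodule_isStarAlgebra (C : numClosedFieldType) A
    & GRing.Lmodule C A := {
  amul : {bilinear A -> A -> A};
  amulA : associative amul;
  astar : A -> A;
  astar_antilinear : forall (a : C) x y,
    astar (a *: x + y) = a^* *: astar x + astar y;
  astarK : involutive astar;
  astarM : forall x y, astar (amul x y) = amul (astar y) (astar x)
}.
#[short(type="starAlgType")]
HB.structure Definition StarAlgebra (C : numClosedFieldType) :=
  {A of GRing.Lmodule C A & Lmodule_isStarAlgebra C A}.
#[short(type="preHilbertStarAlgType")]
HB.structure Definition PreHilbertStarAlgebra (C : numClosedFieldType) :=
  {A of PreHilbert C A & StarAlgebra C A}.

(* W with the scalar action a, w |-> a^* *: w. Antilinear maps into W are linear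
   maps into conj_lmod W, so the universal property also yields them. *)
Definition conj_lmod (C : numClosedFieldType) (W : lmodType C) : Type := W.

Section ConjugateModule.
Variables (C : numClosedFieldType) (W : lmodType C).

HB.instance Definition _ := GRing.Zmodule.on (conj_lmod W).

Definition conj_scale (a : C) (w : conj_lmod W) : conj_lmod W :=
  a^* *: (w : W).

Lemma conj_scaleA a b w : conj_scale a (conj_scale b w) = conj_scale (a * b) w.
Proof. by rewrite /conj_scale scalerA rmorphM. Qed.
Lemma conj_scale1 : left_id 1 conj_scale.
Proof. by move=> w; rewrite /conj_scale rmorph1 scale1r. Qed.
Lemma conj_scaleDr : right_distributive conj_scale +%R.
Proof. by move=> a v w; rewrite /conj_scale scalerDr. Qed.
Lemma conj_scaleDl w : {morph conj_scale^~ w : a b / a + b}.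
Proof. by move=> a b; rewrite /conj_scale rmorphD scalerDl. Qed.

HB.instance Definition _ := GRing.Zmodule_isLmodule.Build C (conj_lmod W)
  conj_scaleA conj_scale1 conj_scaleDr conj_scaleDl.

End ConjugateModule.

Section TensorStarAlgebra.
Variables (C : numClosedFieldType) (A B : starAlgType C).

Definition tensor_amul_form (x' : A) (y' : B) (x : A) (y : B) : tensor A B :=
  ptensor (amul x x') (amul y y').

Lemma tensor_amul_form_bilinear x' y' :
  bilinear_for *:%R *:%R (tensor_amul_form x' y').
Proof.
by split=> [y|x] a u v; rewrite /tensor_amul_form linearPl ?linearPl ?linearPr.
Qed.
HB.instance Definition _ x' y' := bilinear_isBilinear.Build C A B (tensor A B)
  _ _ (tensor_amul_form x' y') (tensor_amul_form_bilinear x' y').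

Definition tensor_amul_form2 (t : tensor A B) (x : A) (y : B) : tensor A B :=
  tensor_lift (tensor_amul_form x y) t.

Lemma tensor_amul_form20 x y : tensor_amul_form2 0 x y = 0.
Proof. exact: (linear0 (tensor_lift (tensor_amul_form x y))). Qed.
Lemma tensor_amul_form2P a s t x y :
  tensor_amul_form2 (a *: s + t) x y =
  a *: tensor_amul_form2 s x y + tensor_amul_form2 t x y.
Proof. exact: (linearP (tensor_lift (tensor_amul_form x y))). Qed.
Lemma tensor_amul_form2D s t x y :
  tensor_amul_form2 (s + t) x y =
  tensor_amul_form2 s x y + tensor_amul_form2 t x y.
Proof. exact: (linearD (tensor_lift (tensor_amul_form x y))). Qed.
Lemma tensor_amul_form2p x y x' y' :
  tensor_amul_form2 (ptensor x y) x' y' = ptensor (amul x x') (amul y y').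
Proof. exact: tensor_liftp. Qed.

Lemma tensor_amul_form2_bilinear t :
  bilinear_for *:%R *:%R (tensor_amul_form2 t).
Proof.
split=> [y|x] a u v /=.
  elim/tensor_ind: t => [|s t ihs iht|x' y'].
  - by rewrite !tensor_amul_form20 scaler0 addr0.
  - by rewrite !tensor_amul_form2D ihs iht scalerDr addrACA.
  by rewrite !tensor_amul_form2p linearPr linearPl.
elim/tensor_ind: t => [|s t ihs iht|x' y'].
- by rewrite !tensor_amul_form20 scaler0 addr0.
- by rewrite !tensor_amul_form2D ihs iht scalerDr addrACA.
by rewrite !tensor_amul_form2p linearPr linearPr.
Qed.
HB.instance Definition _ t := bilinear_isBilinear.Build C A B (tensor A B)
  _ _ (tensor_amul_form2 t) (tensor_amul_form2_bilinear t).

Definition tensor_amul (s t : tensor A B) : tensor A B :=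
  tensor_lift (tensor_amul_form2 s) t.

Lemma tensor_amul_bilinear : bilinear_for *:%R *:%R tensor_amul.
Proof.
split=> [t|s] a u v /=; last first.
  exact: (linearP (tensor_lift (tensor_amul_form2 s))).
rewrite /tensor_amul /tensor_lift /pair_sum scaler_sumr -big_split /=.
by apply: eq_bigr => p _; rewrite tensor_amul_form2P.
Qed.
HB.instance Definition _ := bilinear_isBilinear.Build C _ _ _ _ _
  tensor_amul tensor_amul_bilinear.

Lemma tensor_amulp x y x' y' :
  tensor_amul (ptensor x y) (ptensor x' y') =
  ptensor (amul x x') (amul y y').
Proof. by rewrite /tensor_amul tensor_liftp; exact: tensor_amul_form2p. Qed.

Lemma tensor_amul0l t : tensor_amul 0 t = 0.
Proof. exact: linear0l. Qed.
Lemma tensor_amul0r t : tensor_amul t 0 = 0.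
Proof. exact: linear0r. Qed.
Lemma tensor_amulDl s t u :
  tensor_amul (s + t) u = tensor_amul s u + tensor_amul t u.
Proof. exact: linearDl. Qed.
Lemma tensor_amulDr s t u :
  tensor_amul s (t + u) = tensor_amul s t + tensor_amul s u.
Proof. exact: linearDr. Qed.

Lemma tensor_amulA : associative tensor_amul.
Proof.
move=> s t u; elim/tensor_ind: s => [|s s' ih ih'|x y].
- by rewrite !tensor_amul0l.
- by rewrite !tensor_amulDl ih ih'.
elim/tensor_ind: t => [|t t' ih ih'|x' y'].
- by rewrite !(tensor_amul0l, tensor_amul0r).
- by rewrite !(tensor_amulDl, tensor_amulDr) ih ih'.
elim/tensor_ind: u => [|u u' ih ih'|x2 y2].
- by rewrite !tensor_amul0r.
- by rewrite !tensor_amulDr ih ih'.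
by rewrite !tensor_amulp !amulA.
Qed.

Definition tensor_astar_form (x : A) (y : B) : conj_lmod (tensor A B) :=
  ptensor (astar x) (astar y).

Lemma tensor_astar_form_bilinear : bilinear_for *:%R *:%R tensor_astar_form.
Proof.
split=> [y|x] a u v; rewrite /tensor_astar_form astar_antilinear.
  by rewrite linearPl.
by rewrite linearPr.
Qed.
HB.instance Definition _ := bilinear_isBilinear.Build C A B
  (conj_lmod (tensor A B)) _ _ tensor_astar_form tensor_astar_form_bilinear.

Definition tensor_astar (t : tensor A B) : tensor A B :=
  tensor_lift tensor_astar_form t.

Lemma tensor_astarp x y :
  tensor_astar (ptensor x y) = ptensor (astar x) (astar y).
Proof. exact: (@tensor_liftp C A B (conj_lmod (tensor A B)) tensor_astar_form). Qed.

Lemma tensor_astar_antilinear (a : C) s t :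
  tensor_astar (a *: s + t) = a^* *: tensor_astar s + tensor_astar t.
Proof. exact: (linearP (tensor_lift tensor_astar_form)). Qed.

Lemma tensor_astarD s t : tensor_astar (s + t) = tensor_astar s + tensor_astar t.
Proof. exact: (linearD (tensor_lift tensor_astar_form)). Qed.

Lemma tensor_astar0 : tensor_astar 0 = 0.
Proof. exact: (linear0 (tensor_lift tensor_astar_form)). Qed.

Lemma tensor_astarK : involutive tensor_astar.
Proof.
move=> t; elim/tensor_ind: t => [|s t ihs iht|x y].
- by rewrite !tensor_astar0.
- by rewrite !tensor_astarD ihs iht.
by rewrite !tensor_astarp !astarK.
Qed.

Lemma tensor_astarM s t :
  tensor_astar (tensor_amul s t) =
  tensor_amul (tensor_astar t) (tensor_astar s).
Proof.
elim/tensor_ind: s => [|s s' ih ih'|x y].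
- by rewrite tensor_amul0l tensor_astar0 tensor_amul0r.
- by rewrite tensor_amulDl !tensor_astarD ih ih' tensor_amulDr.
elim/tensor_ind: t => [|t t' ih ih'|x' y'].
- by rewrite tensor_amul0r tensor_astar0 tensor_amul0l.
- by rewrite tensor_amulDr !tensor_astarD ih ih' tensor_amulDl.
by rewrite !(tensor_amulp, tensor_astarp) !astarM.
Qed.

HB.instance Definition _ := Lmodule_isStarAlgebra.Build C (tensor A B)
  tensor_amulA tensor_astar_antilinear tensor_astarK tensor_astarM.

End TensorStarAlgebra.

HB.instance Definition _ (C : numClosedFieldType)
    (A B : preHilbertStarAlgType C) := StarAlgebra.on (tensor A B).

Notation "u ⊗ v" := (ptensor u v) (at level 40, left associativity) : ring_scope.

Section TensorFormulas.
Variable C : numClosedFieldType.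

Lemma ip_tensor_sum (U V : preHilbertType C) (s s' : seq (U * V)) :
  ip (\sum_(p <- s) p.1 ⊗ p.2) (\sum_(q <- s') q.1 ⊗ q.2) =
  \sum_(p <- s) \sum_(q <- s') ip p.1 q.1 * ip p.2 q.2.
Proof. by rewrite -!tensor_ofE; exact: tensor_ip_sum. Qed.

Lemma ip_ptensor (U V : preHilbertType C) (u u' : U) (v v' : V) :
  ip (u ⊗ v) (u' ⊗ v') = ip u u' * ip v v'.
Proof.
by have := ip_tensor_sum [:: (u, v)] [:: (u', v')]; rewrite !big_seq1.
Qed.

Lemma amul_ptensor (A B : starAlgType C) (x x' : A) (y y' : B) :
  amul (x ⊗ y) (x' ⊗ y') = amul x x' ⊗ amul y y'.
Proof. exact: tensor_amulp. Qed.

Lemma astar_ptensor (A B : starAlgType C) (x : A) (y : B) :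
  astar (x ⊗ y) = astar x ⊗ astar y.
Proof. exact: tensor_astarp. Qed.

End TensorFormulas.

(* A0 is seen as a subspace of A through the injection qemb. *)
Record quasi_star_data (C : numClosedFieldType) (A0 : starAlgType C)
    (A : lmodType C) := QuasiStarData {
  qemb : {linear A0 -> A};
  lact : {bilinear A0 -> A -> A};
  ract : {bilinear A -> A0 -> A};
  qstar : A -> A
}.

Record is_quasi_star_algebra (C : numClosedFieldType) (A0 : starAlgType C)
    (A : lmodType C) (D : quasi_star_data A0 A) : Prop := {
  qemb_inj : injective (qemb D);
  qstar_antilinear : forall (c : C) (a b : A),
    qstar D (c *: a + b) = c^* *: qstar D a + qstar D b;
  qstarK : involutive (qstar D);
  qstar_qemb : forall x, qstar D (qemb D x) = qemb D (astar x);
  lactA : forall x y a, lact D (amul x y) a = lact D x (lact D y a);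
  ractA : forall x y a, ract D a (amul x y) = ract D (ract D a x) y;
  lact_ract : forall x y a, ract D (lact D x a) y = lact D x (ract D a y);
  lact_qemb : forall x y, lact D x (qemb D y) = qemb D (amul x y);
  ract_qemb : forall x y, ract D (qemb D x) y = qemb D (amul x y);
  qstar_ract : forall a x, qstar D (ract D a x) = lact D (astar x) (qstar D a)
}.

Definition is_unital (C : numClosedFieldType) (A0 : starAlgType C)
    (A : lmodType C) (D : quasi_star_data A0 A) : Prop :=
  exists e : A0, forall a : A, ract D a e = a /\ lact D e a = a.

Definition linear_span (C : numClosedFieldType) (V : lmodType C) (S : set V)
    : set V :=
  [set x | exists n (c : 'I_n -> C) (v : 'I_n -> V),
     (forall i, S (v i)) /\ x = \sum_(i < n) c i *: v i].

Definition total_set (C : numClosedFieldType) (V : normedModType C) (S : set V)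
    : Prop := dense (linear_span S).

Definition is_completion (C : numClosedFieldType) (V : preHilbertType C)
    (H : hilbertType C) (i : {linear V -> H}) : Prop :=
  (forall x y, ip (i x) (i y) = ip x y) /\ dense (range i).

(* The data lact, ract and qstar on H are required to be continuous. As qemb has
   dense range, they are the unique extensions by continuity of the operations
   of A0, and all the identities in hilbert_quasi_star, apart from the ones
   saying that they extend these operations, follow from those in A0. *)
Record is_hilbert_quasi_star_algebra (C : numClosedFieldType)
    (A0 : preHilbertStarAlgType C) (H : hilbertType C)
    (D : quasi_star_data A0 H) : Prop := {
  amul_continuous : forall x : A0, continuous (amul x : A0 -> A0);
  ip_amul : forall x y z : A0, ip (amul x y) z = ip y (amul (astar x) z);
  ip_astar : forall x y : A0, ip x y = ip (astar y) (astar x);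
  amul_total : total_set [set z : A0 | exists x y, z = amul x y];
  qemb_completion : is_completion (qemb D);
  hilbert_quasi_star : is_quasi_star_algebra D;
  lact_continuous : forall x, continuous (lact D x : H -> H);
  ract_continuous : forall x, continuous ((ract D)^~ x : H -> H);
  qstar_continuous : continuous (qstar D : H -> H)
}.

Definition is_unital_hilbert_quasi_star_algebra (C : numClosedFieldType)
    (A0 : preHilbertStarAlgType C) (H : hilbertType C)
    (D : quasi_star_data A0 H) : Prop :=
  is_hilbert_quasi_star_algebra D /\ is_unital D.

(* Main.v *)
Require Import Defs.
From HB Require Import structures.
From mathcomp Require Import all_boot all_order all_algebra sesquilinear complex.
From mathcomp Require Import boolp classical_sets reals topology normedtype.
From mathcomp Require Import ring.

Set Implicit Arguments.
Unset Strict Implicit.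
Unset Printing Implicit Defensive.

Import Order.TTheory GRing.Theory Num.Theory.
Import numFieldNormedType.Exports.
Local Open Scope classical_set_scope.
Local Open Scope ring_scope.

(** The operations on the completion are obtained from those of the *-algebra
    A0 ⊗ B0 alone; the modules H1 and H2 enter only when the result is compared
    with elementary tensors.

    The inclusions of A0 and B0 are isometric with dense range, hence so is
    their tensor product A0 ⊗ B0 -> H1 ⊗ H2 (tensor_map_isometry and
    tensor_map_dense). Composed with j it exhibits K as a completion of A0 ⊗ B0,
    and two completions of one space are canonically isometric
    (completion_unique).

    A pre-Hilbert *-algebra that satisfies the four axioms always makes its
    completion a quasi *-algebra (completion_quasi_star): left multiplications
    are bounded, the involution is isometric, so right multiplications are
    bounded as well, and all three extend by continuity
    (semilinear_extension). Each identity to be checked equates two continuous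
    maps which agree on a dense subspace (dense_range_continuous_eq).

    It remains to see that A0 ⊗ B0 satisfies the axioms. The algebraic ones are
    checked on elementary tensors, and totality of the products follows from
    the unit. The analytic one is the continuity of left multiplication. By
    linearity it concerns the operators f ⊗ g with f and g bounded
    (tensor_map_bounded). Writing a tensor as a sum of e_k ⊗ v_k with e_k
    orthonormal, its squared norm is the sum of the |v_k|^2, which bounds
    id ⊗ g; exchanging the factors bounds f ⊗ id.

    Finally, an elementary tensor depends continuously on each factor, so the
    formulas for the operations on xi ⊗ eta follow, one variable at a time, from
    the case where xi and eta come from A0 and B0. *)

(** * Bounded semilinear maps *)

Section BoundedMaps.
Variables (C : numFieldType).
Implicit Types U V W : normedModType C.

(** Linear maps are the case s = id and antilinear ones the case where s is
    the conjugation. *)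
Definition semilinear_via (s : {rmorphism C -> C}) (U V : lmodType C) (f : U -> V) :=
  forall a x y, f (a *: x + y) = s a *: f x + f y.

Definition bounded_map V W (f : V -> W) :=
  exists2 M : C, 0 < M & forall v, `|f v| <= M * `|v|.

Lemma semilinearB s (V W : lmodType C) (f : V -> W) :
  semilinear_via s f -> forall x y, f (x - y) = f x - f y.
Proof.
move=> fs x y; apply/eqP; rewrite eq_sym subr_eq eq_sym.
by have := fs 1 (x - y) y; rewrite rmorph1 !scale1r subrK => <-.
Qed.

Lemma linear_semilinear (V W : lmodType C) (f : {linear V -> W}) :
  semilinear_via idfun f.
Proof. by move=> a x y; rewrite linearP. Qed.

Lemma bounded_semilinear_continuous s V W (f : V -> W) :
  semilinear_via s f -> bounded_map f -> continuous f.
Proof.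
move=> fs [M M0 fM] x; apply/cvgrPdist_lt => e e0; near=> y.
rewrite -(semilinearB fs); apply: le_lt_trans (fM _) _.
rewrite mulrC -ltr_pdivlMr //.
near: y; apply: (cvgr_dist_lt (V := V)) => //; exact: divr_gt0.
Unshelve. all: by end_near. Qed.

Lemma linear_continuous_bounded_map V W (f : {linear V -> W}) :
  continuous f -> bounded_map f.
Proof.
move=> fc; have /linear_boundedP [M [Mr fM]] :=
  continuous_linear_bounded 0 (fc 0).
have M1 : M < `|M| + 1 by rewrite ltr_pwDr // real_ler_norm.
exists (`|M| + 1); last exact: fM.
by rewrite ltr_wpDl.
Qed.

Lemma bounded_map_comp U V W (f : V -> W) (g : U -> V) :
  bounded_map f -> bounded_map g -> bounded_map (f \o g).
Proof.
move=> [M M0 fM] [N N0 gN]; exists (M * N) => [|v /=]; first exact: mulr_gt0.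
by rewrite -mulrA; apply: le_trans (fM _) _; rewrite ler_pM2l.
Qed.

Lemma bounded_mapD V W (f g : V -> W) :
  bounded_map f -> bounded_map g -> bounded_map (fun v => f v + g v).
Proof.
move=> [M M0 fM] [N N0 gN]; exists (M + N) => [|v]; first exact: addr_gt0.
by rewrite mulrDl; apply: le_trans (ler_normD _ _) (lerD (fM _) (gN _)).
Qed.

Lemma isometry_bounded_map V W (f : V -> W) :
  (forall v, `|f v| = `|v|) -> bounded_map f.
Proof. by move=> fE; exists 1 => // v; rewrite mul1r fE. Qed.

End BoundedMaps.

(** * Extension by continuity from a dense subspace *)

Section DenseRange.
Variables (C : numFieldType) (T : Type) (H : normedModType C) (i : T -> H).

Lemma dense_rangeP :
  dense (range i) <-> forall h (e : C), 0 < e -> exists v, `|h - i v| < e.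
Proof.
split=> [di h e e0|di O [h Oh] oO].
  have [] := di (ball h e); [by exists h; exact: ballxx|exact: ball_open|].
  by move=> x [xh [v _ vx]]; exists v; move: xh; rewrite -vx -ball_normE.
have /nbhs_ballP [e /= e0 eO] : nbhs h O by exact: open_nbhs_nbhs.
have [v hv] := di h e e0; exists (i v); split; last by exists v.
by apply: eO; rewrite -ball_normE.
Qed.

Lemma dense_range_continuous_eq (W : normedModType C) (f g : H -> W) :
  dense (range i) -> continuous f -> continuous g ->
  (forall v, f (i v) = g (i v)) -> f =1 g.
Proof.
move=> di fc gc fg h; apply/eqP; rewrite -subr_eq0 -normr_le0.
apply: contraT; rewrite -real_ltNge ?normr_real ?real0 // => d0.
have [e e0 eE] : exists2 e : C, 0 < e & `|f h - g h| = e + e.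
  by exists (`|f h - g h| / 2); [exact: divr_gt0|rewrite -splitr].
have : \forall x \near h, `|f h - f x| < e /\ `|g h - g x| < e.
  near=> x; split; near: x.
    by have /cvgrPdist_lt := fc h; apply.
  by have /cvgrPdist_lt := gc h; apply.
move=> /nbhs_ballP [r /= r0 rE].
have [v hv] := (dense_rangeP.1 di) h r r0.
have [|fe ge] := rE (i v); first by rewrite -ball_normE.
suff : `|f h - g h| < e + e by rewrite eE ltxx.
rewrite (_ : f h - g h = (f h - f (i v)) - (g h - g (i v))).
  by apply: le_lt_trans (ler_normB _ _) (ltrD fe ge).
by rewrite fg opprB addrA subrK.
Unshelve. all: by end_near. Qed.

End DenseRange.

Section Extension.
Variables (C : numFieldType) (V H : normedModType C).
Variables (W : completeNormedModType C) (i : {linear V -> H}).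
Hypotheses (iN : forall v, `|i v| = `|v|) (di : dense (range i)).
Variables (s : {rmorphism C -> C}) (f : V -> W) (fs : semilinear_via s f).

(** The extension of f along i is the closure of its graph, transported by i to
    H * W. In this form semilinearity and the norm bound pass to the limit by
    choosing one approximation for each argument. *)
Definition graph_closure (h : H) (k : W) :=
  forall e : C, 0 < e -> exists v, `|h - i v| < e /\ `|k - f v| < e.

(** The images under f of the points of V close to h form a Cauchy filter base,
    because f is bounded and i isometric; completeness of W gives a limit. *)
Lemma graph_closure_exists : bounded_map f -> forall h, exists k, graph_closure h k.
Proof.
move=> [M M0 fM] h.
pose B (e : C) : set W := [set f v | v in [set v | `|h - i v| < e]].
pose F := filter_from [set e : C | 0 < e] B.
have FP : ProperFilter F.
  apply: filter_from_proper.
    apply: filter_from_filter; first by exists 1 => /=.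
    move=> d e /= d0 e0.
    have [de|/ltW ed] := real_leP (gtr0_real d0) (gtr0_real e0).
      by exists d => // _ [v hv <-]; split; exists v => //=; exact: lt_le_trans de.
    by exists e => // _ [v hv <-]; split; exists v => //=; exact: lt_le_trans ed.
  move=> e /= e0; have [v hv] := (dense_rangeP i).1 di h e e0.
  by exists (f v), v.
have Fc : cauchy F.
  apply: cauchy_exP => e e0; pose d := e / 2 / M.
  have d0 : 0 < d by rewrite !divr_gt0.
  have [v0 hv0] := (dense_rangeP i).1 di h d d0.
  exists (f v0); exists d => // _ [v hv <-].
  rewrite -ball_normE /= -(semilinearB fs); apply: le_lt_trans (fM _) _.
  rewrite -iN linearB /= mulrC -ltr_pdivlMr // [e]splitr mulrDl.
  rewrite -[i v0 - _](subrKA h); apply: le_lt_trans (ler_normD _ _) _.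
  by rewrite ltrD // distrC.
have Fk : F --> lim F by exact: (cauchy_cvg F).
exists (lim F) => e e0; have [k []] : B e `&` ball (lim F) e !=set0.
  apply: (@filter_ex _ F); apply: filterI; first by exists e.
  by apply: Fk; apply: nbhsx_ballx.
by move=> [v hv <-]; rewrite -ball_normE; exists v.
Qed.


Lemma graph_closure_semilinear a h h' k k' :
  graph_closure h k -> graph_closure h' k' ->
  graph_closure (a *: h + h') (s a *: k + k').
Proof.
move=> hk hk' e e0.
(* The approximations in H and in W are scaled by a and by s a; N controls both. *)
pose N := `|a| + `|s a| + 1.
have N0 : 0 < N by rewrite ltr_wpDl ?addr_ge0.
have [|v [hv kv]] := hk (e / 2 / N); first by rewrite !divr_gt0.
have [|v' [hv' kv']] := hk' (e / 2); first by rewrite divr_gt0.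
have small (b : C) (X : normedModType C) (x y x' y' : X) : `|b| <= N ->
    `|x - y| < e / 2 / N -> `|x' - y'| < e / 2 ->
    `|b *: x + x' - (b *: y + y')| < e.
  move=> bN xy xy'; rewrite opprD addrACA -scalerBr [e]splitr.
  apply: le_lt_trans (ler_normD _ _) (ler_ltD _ xy').
  rewrite normrZ mulrC; apply: le_trans (ler_pM _ _ (ltW xy) bN) _ => //.
  by rewrite divfK ?gt_eqF.
exists (a *: v + v'); rewrite linearP fs; split; apply: small => //.
  by rewrite /N -addrA lerDl addr_ge0.
by rewrite /N addrAC lerDr addr_ge0.
Qed.

Lemma graph_closure_bound (M : C) : 0 < M -> (forall v, `|f v| <= M * `|v|) ->
  forall h k, graph_closure h k -> `|k| <= M * `|h|.
Proof.
move=> M0 fM h k hk; apply: contraT.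
rewrite -real_ltNge ?realM ?normr_real ?gtr0_real // -subr_gt0 => d0.
have M1 : 0 < M + 1 by rewrite addr_gt0.
pose e := (`|k| - M * `|h|) / (M + 1).
have [|v [hv kv]] := hk e; first by rewrite divr_gt0.
suff : `|k| < M * (`|h| + e) + e.
  rewrite mulrDr -addrA -[X in _ + (_ + X)]mul1r -mulrDl.
  rewrite /e [(M + 1) * _]mulrC divfK ?gt_eqF //.
  by rewrite subrKC ltxx.
rewrite -[k in `|k|](subrK (f v)) addrC; apply: le_lt_trans (ler_normD _ _) _.
rewrite ler_ltD //; apply: le_trans (fM v) _; rewrite ler_pM2l // -iN.
rewrite -[i v](subKr h); apply: le_trans (ler_normB _ _) _.
by rewrite lerD2l ltW.
Qed.

(** A bounded semilinear map extends with the same bound. Single-valuedness of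
    the closure of the graph is the bound for the pair (0, k - k'). *)
Lemma semilinear_extension (M : C) : 0 < M -> (forall v, `|f v| <= M * `|v|) ->
  exists g : H -> W,
    [/\ forall v, g (i v) = f v, semilinear_via s g & forall h, `|g h| <= M * `|h|].
Proof.
move=> M0 fM; have Gb := graph_closure_bound M0 fM.
have [g gP] := choice (graph_closure_exists (ex_intro2 _ _ M M0 fM)).
have Gu h k : graph_closure h k -> g h = k.
  move=> hk; have := graph_closure_semilinear (-1) hk (gP h).
  move=> /Gb; rewrite rmorphN1 !scaleN1r addNr normr0 mulr0 normr_le0.
  by rewrite addrC subr_eq0 => /eqP.
exists g; split=> [v|a x y|h].
- by apply: Gu => e e0; exists v; rewrite !subrr !normr0.
- by apply: Gu; apply: graph_closure_semilinear.
- exact: Gb.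
Qed.

End Extension.

Lemma linear_extension (C : numFieldType) (V H : normedModType C)
    (W : completeNormedModType C) (i : {linear V -> H}) (f : {linear V -> W}) (M : C) :
  (forall v, `|i v| = `|v|) -> dense (range i) ->
  0 < M -> (forall v, `|f v| <= M * `|v|) ->
  exists g : {linear H -> W}, (forall v, g (i v) = f v) /\ forall h, `|g h| <= M * `|h|.
Proof.
move=> iN di M0 fM.
have [g [gf gl gM]] := semilinear_extension iN di (linear_semilinear f) M0 fM.
pose gL := GRing.isLinear.Build C H W *:%R g gl.
by exists (HB.pack_for {linear H -> W} g gL).
Qed.

(** * Completions of pre-Hilbert spaces *)

Section Completions.
Variable C : numClosedFieldType.

Lemma isometry_norm (V W : preHilbertType C) (f : V -> W) :
  (forall x y, ip (f x) (f y) = ip x y) -> forall x, `|f x| = `|x|.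
Proof.
move=> fi x; apply/eqP; rewrite -(@eqrXn2 _ 2) //.
by rewrite !ip_norm fi.
Qed.

(** Polarization. The defect d of f is sesquilinear and vanishes on the diagonal,
    so a^* d(x, y) + a d(y, x) = 0; taking a = 1 and a = 'i gives d = 0. *)
Lemma norm_isometry_ip (V W : preHilbertType C) (f : {linear V -> W}) :
  (forall x, `|f x| = `|x|) -> forall x y, ip (f x) (f y) = ip x y.
Proof.
move=> fN.
pose d x y := ip (f x) (f y) - ip x y.
have d0 x : d x x = 0 by rewrite /d -!ip_norm fN subrr.
have dE (a : C) x y : a^* * d x y + a * d y x = 0.
  have : d (x + a *: y) (x + a *: y) =
    d x x + a * a^* * d y y + (a^* * d x y + a * d y x).
    rewrite /d linearD linearZ /= !(ipDl, ipDr, ipZl, ipZr).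
    by rewrite !mulrBr !opprD !mulrA; ring.
  by rewrite !d0 mulr0 !add0r.
move=> x y; have := dE 'i x y; have := dE 1 x y.
rewrite conjCi rmorph1 !mul1r => /eqP; rewrite addrC addr_eq0 => /eqP ->.
rewrite mulrN mulNr -opprD -mulr2n => /eqP.
by rewrite oppr_eq0 mulrn_eq0 mulf_eq0 (negPf (neq0Ci _)) /= subr_eq0 => /eqP.
Qed.

(** Each embedding extends along the other. The two extensions are mutually
    inverse by density, and as both are contractions they are isometric. *)
Lemma completion_unique (V : preHilbertType C) (K0 K : hilbertType C)
    (j0 : {linear V -> K0}) (j : {linear V -> K}) :
  is_completion j0 -> is_completion j ->
  exists Phi : {linear K0 -> K},
    [/\ bijective Phi, forall a b, ip (Phi a) (Phi b) = ip a b
      & forall t, Phi (j0 t) = j t].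
Proof.
move=> [j0i j0d] [ji jd].
have j0N := isometry_norm j0i; have jN := isometry_norm ji.
have [|Phi [Phij0 PhiN]] := linear_extension (f := j) j0N j0d ltr01.
  by move=> v; rewrite mul1r jN.
have [|Psi [Psij PsiN]] := linear_extension (f := j0) jN jd ltr01.
  by move=> v; rewrite mul1r j0N.
have Phic : continuous Phi.
  by apply: (bounded_semilinear_continuous (linear_semilinear Phi)); exists 1.
have Psic : continuous Psi.
  by apply: (bounded_semilinear_continuous (linear_semilinear Psi)); exists 1.
have PhiK : cancel Phi Psi.
  apply: (dense_range_continuous_eq (f := Psi \o Phi) j0d).
  - by move=> x; apply: continuous_comp; [exact: Phic|exact: Psic].
  - by move=> x; exact: cvg_id.
  - by move=> v /=; rewrite Phij0 Psij.
have PsiK : cancel Psi Phi.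
  apply: (dense_range_continuous_eq (f := Phi \o Psi) jd).
  - by move=> x; apply: continuous_comp; [exact: Psic|exact: Phic].
  - by move=> x; exact: cvg_id.
  - by move=> v /=; rewrite Psij Phij0.
exists Phi; split=> //; first by exists Psi.
apply: norm_isometry_ip => x; apply/eqP; rewrite eq_le.
have := PhiN x; have := PsiN (Phi x).
by rewrite PhiK !mul1r => -> ->.
Qed.

End Completions.

(** * The quasi *-algebra structure on a completion *)

Section QuasiStarCompletion.
Variables (C : numClosedFieldType) (A : preHilbertStarAlgType C).
Hypotheses (amul_cont : forall x : A, continuous (amul x : A -> A))
  (ip_amulA : forall x y z : A, ip (amul x y) z = ip y (amul (astar x) z))
  (ip_astarA : forall x y : A, ip x y = ip (astar y) (astar x))
  (amul_totA : total_set [set z : A | exists x y, z = amul x y]).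

Lemma norm_astar (x : A) : `|astar x| = `|x|.
Proof.
apply/eqP; rewrite -(@eqrXn2 _ 2) //.
by rewrite !ip_norm -ip_astarA.
Qed.

(** Continuity is assumed for left multiplications only; x y = (y^* x^* )^* and
    the isometric involution transfer it to the right ones. *)
Lemma amulr_bounded (y : A) : bounded_map (fun x : A => amul x y).
Proof.
have [M M0 yM] := linear_continuous_bounded_map (@amul_cont (astar y)).
exists M => // x; rewrite -norm_astar astarM.
by apply: le_trans (yM _) _; rewrite norm_astar.
Qed.

Variables (H : hilbertType C) (i : {linear A -> H}) (ic : is_completion i).

(** The three operations are the extensions by continuity of those of A, and
    every identity between them follows from the one in A by density. *)
Lemma completion_quasi_star :
  exists D : quasi_star_data A H,
    qemb D = i /\ is_hilbert_quasi_star_algebra D.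
Proof.
have [ii di] := ic; have iN := isometry_norm ii.
have ext (f : {linear A -> A}) : bounded_map f ->
    exists g : {linear H -> H}, continuous g /\ forall x, g (i x) = i (f x).
  move=> [M M0 fM].
  have [|g [gi gM]] := linear_extension (f := i \o f) iN di M0.
    by move=> v /=; rewrite iN; exact: fM.
  exists g; split=> //.
  by apply: (bounded_semilinear_continuous (linear_semilinear g)); exists M.
have /choice [l lP] : forall x, exists g : {linear H -> H},
    continuous g /\ forall y, g (i y) = i (amul x y).
  by move=> x; exact: (ext _ (linear_continuous_bounded_map (@amul_cont x))).
have /choice [r rP] : forall x, exists g : {linear H -> H},
    continuous g /\ forall y, g (i y) = i (amul y x).
  by move=> x; exact: (ext (applyr amul x) (amulr_bounded x)).
have [st [sti sts stM]] : exists st : H -> H, [/\ forall x, st (i x) = i (astar x),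
    semilinear_via Num.conj st & forall h, `|st h| <= 1 * `|h|].
  apply: (semilinear_extension (f := i \o astar) iN di).
  - by move=> a x y /=; rewrite astar_antilinear linearP.
  - exact: ltr01.
  - by move=> x /=; rewrite iN norm_astar mul1r.
have stc : continuous st.
  by apply: (bounded_semilinear_continuous sts); exists 1.
have lc x := (lP x).1; have li x := (lP x).2.
have rc x := (rP x).1; have ri x := (rP x).2.
have comp (f g : H -> H) : continuous f -> continuous g -> continuous (f \o g).
  by move=> fc gc x; apply: continuous_comp; [exact: gc|exact: fc].
have lin (a : C) (f g : H -> H) : continuous f -> continuous g ->
    continuous (fun h => a *: f h + g h).
  move=> fc gc x; apply: cvgD; last exact: gc.
  by apply: cvgZr; exact: fc.
have lb : bilinear_for *:%R *:%R (fun x h => l x h).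
  split=> [h|x] a u v /=; last by rewrite linearP.
  pose rhs h := a *: l u h + l v h; rewrite -[RHS]/(rhs h); move: h.
  apply: (dense_range_continuous_eq di) => // [|x]; first exact: lin.
  by rewrite /rhs !li linearPl linearP.
have rb : bilinear_for *:%R *:%R (fun h x => r x h).
  split=> [x|h] a u v /=; first by rewrite linearP.
  pose rhs h := a *: r u h + r v h; rewrite -[RHS]/(rhs h); move: h.
  apply: (dense_range_continuous_eq di) => // [|x]; first exact: lin.
  by rewrite /rhs !ri linearPr linearP.
pose L := HB.pack_for {bilinear A -> H -> H} (fun x h => l x h)
  (bilinear_isBilinear.Build C A H H _ _ (fun x h => l x h) lb).
pose R := HB.pack_for {bilinear H -> A -> H} (fun h x => r x h)
  (bilinear_isBilinear.Build C H A H _ _ (fun h x => r x h) rb).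
exists (QuasiStarData i L R st); split=> //; split=> //; split=> //=.
- move=> x y xy; apply/eqP.
  by rewrite -subr_eq0 -normr_eq0 -iN linearB /= xy subrr normr0.
- apply: (dense_range_continuous_eq (f := st \o st) di) => [||x /=].
  + exact: comp.
  + by move=> x; exact: cvg_id.
  + by rewrite !sti astarK.
- move=> x y; apply: (dense_range_continuous_eq (g := l x \o l y) di) => // [|a /=].
    exact: comp.
  by rewrite !li amulA.
- move=> x y; apply: (dense_range_continuous_eq (g := r y \o r x) di) => // [|a /=].
    exact: comp.
  by rewrite !ri amulA.
- move=> x y.
  apply: (dense_range_continuous_eq (f := r y \o l x) (g := l x \o r y) di).
  + exact: comp.
  + exact: comp.
  + by move=> a /=; rewrite !(li, ri) amulA.
- move=> a x; move: a.
  apply: (dense_range_continuous_eq (f := st \o r x) (g := l (astar x) \o st) di).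
  + exact: comp.
  + exact: comp.
  + by move=> a /=; rewrite !(sti, li, ri) astarM.
Qed.

End QuasiStarCompletion.

Section Unit.
Variables (C : numClosedFieldType) (A : preHilbertStarAlgType C).
Variables (H : hilbertType C) (D : quasi_star_data A H).
Hypothesis hD : is_hilbert_quasi_star_algebra D.

(** The unit of the module is a unit of the *-algebra because the embedding is
    injective; the converse holds by density. *)
Lemma is_unitalP :
  is_unital D <-> exists e : A, forall x, amul e x = x /\ amul x e = x.
Proof.
have hQ := hilbert_quasi_star hD; have [_ dD] := qemb_completion hD.
split=> [] [e eP]; exists e => x.
  have [xe ex] := eP (qemb D x).
  split; apply: (qemb_inj hQ); first by rewrite -(lact_qemb hQ).
  by rewrite -(ract_qemb hQ).
have idc : continuous (@id H) by move=> h; exact: cvg_id.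
split; move: x; apply: (dense_range_continuous_eq (g := id) dD) => //.
- exact: ract_continuous.
- by move=> a; rewrite (ract_qemb hQ) (eP a).2.
- exact: lact_continuous.
- by move=> a; rewrite (lact_qemb hQ) (eP a).1.
Qed.

End Unit.

(** * The norm of the tensor product *)

Section TensorNorm.
Variable C : numClosedFieldType.

Lemma norm_ptensor (U V : preHilbertType C) (u : U) (v : V) :
  `|u ⊗ v| = `|u| * `|v|.
Proof.
apply/eqP; rewrite -(@eqrXn2 _ 2) ?mulr_ge0 //.
by rewrite exprMn !ip_norm ip_ptensor.
Qed.

Lemma ptensorl_continuous (U V : preHilbertType C) (u : U) :
  continuous (fun v : V => u ⊗ v).
Proof.
have fl : semilinear_via idfun (fun v : V => u ⊗ v) by move=> a x y; exact: linearPr.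
apply: (bounded_semilinear_continuous fl).
exists (`|u| + 1) => [|v]; first by rewrite ltr_wpDl.
by rewrite norm_ptensor mulrDl mul1r lerDl.
Qed.

Lemma ptensorr_continuous (U V : preHilbertType C) (v : V) :
  continuous (fun u : U => u ⊗ v).
Proof.
have fl : semilinear_via idfun (fun u : U => u ⊗ v) by move=> a x y; exact: linearPl.
apply: (bounded_semilinear_continuous fl).
exists (`|v| + 1) => [|u]; first by rewrite ltr_wpDl.
by rewrite norm_ptensor mulrC mulrDl mul1r lerDl.
Qed.

Lemma norm_tensor_orthonormal (U V : preHilbertType C) n
    (e : 'I_n -> U) (v : 'I_n -> V) :
  (forall k, ip (e k) (e k) = 1) -> (forall k l, k != l -> ip (e k) (e l) = 0) ->
  `|\sum_(k < n) e k ⊗ v k| ^+ 2 = \sum_(k < n) `|v k| ^+ 2.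
Proof.
move=> e1 eo; rewrite ip_norm.
have := ip_tensor_sum [seq (e k, v k) | k <- index_enum 'I_n]
  [seq (e k, v k) | k <- index_enum 'I_n].
rewrite !big_map => ->; apply: eq_bigr => k _; rewrite big_map.
rewrite (bigD1 k) //= e1 mul1r big1 ?addr0 ?ip_norm // => l lk.
by rewrite eo ?mul0r // eq_sym.
Qed.

Lemma tensor_orthonormal_sum (U V : preHilbertType C) (t : tensor U V) :
  exists n (e : 'I_n -> U) (v : 'I_n -> V),
    [/\ forall k, ip (e k) (e k) = 1, forall k l, k != l -> ip (e k) (e l) = 0
      & t = \sum_(k < n) e k ⊗ v k].
Proof.
have [n [e [v [e1 [eo]]]]] := tensor_orthogonalize (tensor_repr t).
by rewrite tensor_reprK; exists n, e, v.
Qed.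

(** The exchange of the factors. Since orthonormalization is available for left
    factors, it reduces f ⊗ id to id ⊗ f. *)
Definition tensor_swap_form (U V : lmodType C) (u : U) (v : V) : tensor V U :=
  v ⊗ u.

Lemma tensor_swap_form_bilinear (U V : lmodType C) :
  bilinear_for *:%R *:%R (@tensor_swap_form U V).
Proof.
by split=> [v|u] a x y; rewrite /tensor_swap_form ?linearPl ?linearPr.
Qed.
HB.instance Definition _ (U V : lmodType C) :=
  bilinear_isBilinear.Build C U V (tensor V U) _ _
  (@tensor_swap_form U V) (@tensor_swap_form_bilinear U V).

Definition tensor_swap (U V : lmodType C) : tensor U V -> tensor V U :=
  tensor_lift (@tensor_swap_form U V).
HB.instance Definition _ (U V : lmodType C) :=
  GRing.Linear.on (@tensor_swap U V).

Lemma tensor_swapp (U V : lmodType C) (u : U) (v : V) :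
  tensor_swap (u ⊗ v) = v ⊗ u.
Proof. exact: (tensor_liftp (@tensor_swap_form U V)). Qed.

Lemma norm_tensor_swap (U V : preHilbertType C) (t : tensor U V) :
  `|tensor_swap t| = `|t|.
Proof.
apply: isometry_norm => {t} s t.
elim/tensor_ind: s => [|s s' ih ih'|u v].
- by rewrite !linear0 !linear0l.
- by rewrite linearD /= !ipDl ih ih'.
elim/tensor_ind: t => [|t t' ih ih'|u' v'].
- by rewrite !linear0 ?linear0r.
- by rewrite linearD /= !ipDr ih ih'.
by rewrite !tensor_swapp !ip_ptensor mulrC.
Qed.

(** With orthonormal left factors e_k, the squared norms of the sum of the
    e_k ⊗ v_k and of its image are the sums of |v_k|^2 and of |g v_k|^2. *)
Lemma tensor_map_id_bounded (U V V' : preHilbertType C) (g : {linear V -> V'}) :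
  bounded_map g ->
  bounded_map (tensor_map idfun g : tensor U V -> tensor U V').
Proof.
move=> [M M0 gM]; exists M => // t.
have [n [e [v [e1 eo ->]]]] := tensor_orthonormal_sum t.
rewrite -(@ler_pXn2r _ 2) ?nnegrE ?mulr_ge0 ?(ltW M0) // exprMn linear_sum /=.
under [X in `|X|]eq_bigr do rewrite tensor_mapp /=.
rewrite !norm_tensor_orthonormal // mulr_sumr; apply: ler_sum => k _.
by rewrite -exprMn ler_pXn2r ?nnegrE ?mulr_ge0 ?(ltW M0).
Qed.

(** f ⊗ g is the composite of id ⊗ g with f ⊗ id, and the latter is id ⊗ f
    conjugated by the exchange of the factors. *)
Lemma tensor_map_bounded (U V U' V' : preHilbertType C)
    (f : {linear U -> U'}) (g : {linear V -> V'}) :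
  bounded_map f -> bounded_map g ->
  bounded_map (tensor_map f g : tensor U V -> tensor U' V').
Proof.
move=> fb gb.
have fb' := tensor_map_id_bounded V' fb.
have gb' := tensor_map_id_bounded U gb.
have [M M0 hM] := bounded_map_comp
  (isometry_bounded_map (@norm_tensor_swap V' U')) (bounded_map_comp fb'
  (bounded_map_comp (isometry_bounded_map (@norm_tensor_swap U V')) gb')).
exists M => // t; suff -> : tensor_map f g t = tensor_swap (tensor_map idfun f
    (tensor_swap (tensor_map idfun g t))) by exact: hM.
elim/tensor_ind: t => [|s t ihs iht|u v]; first by rewrite !linear0.
  by rewrite !linearD /= ihs iht.
by rewrite !(tensor_mapp, tensor_swapp).
Qed.

Lemma tensor_map_isometry (U V U' V' : preHilbertType C)
    (f : {linear U -> U'}) (g : {linear V -> V'}) :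
  (forall x y, ip (f x) (f y) = ip x y) -> (forall x y, ip (g x) (g y) = ip x y) ->
  forall s t, ip (tensor_map f g s) (tensor_map f g t) = ip s t.
Proof.
move=> fi gi s t; elim/tensor_ind: s => [|s s' ih ih'|u v].
- by rewrite !linear0 !linear0l.
- by rewrite linearD /= !ipDl ih ih'.
elim/tensor_ind: t => [|t t' ih ih'|u' v'].
- by rewrite !linear0 ?linear0r.
- by rewrite linearD /= !ipDr ih ih'.
by rewrite !tensor_mapp !ip_ptensor fi gi.
Qed.

(** Elementary tensors are approximated by elementary tensors, from
    u ⊗ v - f x ⊗ g y = (u - f x) ⊗ v + f x ⊗ (v - g y): x is chosen first, and
    y at a precision that depends on the norm of f x. *)
Lemma tensor_map_dense (U V U' V' : preHilbertType C)
    (f : {linear U -> U'}) (g : {linear V -> V'}) :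
  dense (range f) -> dense (range g) -> dense (range (tensor_map f g)).
Proof.
move=> /dense_rangeP df /dense_rangeP dg; apply/dense_rangeP => t.
elim/tensor_ind: t => [|s t ihs iht|u v] e e0.
- by exists 0; rewrite linear0 subr0 normr0.
- have e2 : 0 < e / 2 by exact: divr_gt0.
  have [s' ss'] := ihs _ e2; have [t' tt'] := iht _ e2.
  exists (s' + t'); rewrite linearD /= opprD addrACA [e]splitr.
  by apply: le_lt_trans (ler_normD _ _) (ltrD ss' tt').
have e2 : 0 < e / 2 by exact: divr_gt0.
pose Nv := `|v| + 1; have Nv0 : 0 < Nv by rewrite ltr_wpDl.
have [|x ux] := df u (e / 2 / Nv); first by rewrite divr_gt0.
pose Nx := `|f x| + 1; have Nx0 : 0 < Nx by rewrite ltr_wpDl.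
have [|y vy] := dg v (e / 2 / Nx); first by rewrite divr_gt0.
exists (x ⊗ y); rewrite tensor_mapp.
have -> : u ⊗ v - f x ⊗ g y = (u - f x) ⊗ v + f x ⊗ (v - g y).
  by rewrite linearBl /= linearBr /= addrA subrK.
rewrite [e]splitr; apply: le_lt_trans (ler_normD _ _) _; rewrite !norm_ptensor.
have Nv1 : `|v| <= Nv by rewrite lerDl.
have Nx1 : `|f x| <= Nx by rewrite lerDl.
rewrite ltrD //.
  apply: le_lt_trans (ler_wpM2l (normr_ge0 _) Nv1) _.
  by rewrite -ltr_pdivlMr.
apply: le_lt_trans (ler_wpM2r (normr_ge0 _) Nx1) _.
by rewrite mulrC -ltr_pdivlMr.
Qed.

End TensorNorm.

(** * The tensor product of two pre-Hilbert *-algebras *)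

Lemma astarD (C : numClosedFieldType) (A : starAlgType C) (x y : A) :
  astar (x + y) = astar x + astar y.
Proof. by have := astar_antilinear 1 x y; rewrite rmorph1 !scale1r. Qed.

Lemma astar0 (C : numClosedFieldType) (A : starAlgType C) : astar (0 : A) = 0.
Proof. by apply: (addrI (astar 0)); rewrite -astarD !addr0. Qed.

Section TensorStarAlgebra.
Variables (C : numClosedFieldType) (A B : preHilbertStarAlgType C).

(** Left multiplication by x ⊗ y is the tensor product of the left
    multiplications by x and by y. *)
Lemma tensor_amul_continuous :
  (forall x : A, continuous (amul x : A -> A)) ->
  (forall y : B, continuous (amul y : B -> B)) ->
  forall t : tensor A B, continuous (amul t : tensor A B -> tensor A B).
Proof.
move=> cA cB t.
suff tb : bounded_map (fun u : tensor A B => amul t u).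
  exact: (bounded_semilinear_continuous (linear_semilinear (amul t))).
elim/tensor_ind: t => [|s t sb tb|x y].
- by exists 1 => // s; rewrite linear0l normr0 mulr_ge0.
- have [M M0 stM] := bounded_mapD sb tb.
  by exists M => // u; rewrite linearDl; exact: stM.
have [M M0 xyM] := tensor_map_bounded
  (linear_continuous_bounded_map (@cA x)) (linear_continuous_bounded_map (@cB y)).
exists M => // t; suff -> : amul (x ⊗ y) t = tensor_map (amul x) (amul y) t by [].
elim/tensor_ind: t => [|s t ihs iht|u v].
- by rewrite !linear0.
- by rewrite !linearD /= ihs iht.
by rewrite tensor_mapp amul_ptensor.
Qed.

Lemma tensor_ip_amul :
  (forall x y z : A, ip (amul x y) z = ip y (amul (astar x) z)) ->
  (forall x y z : B, ip (amul x y) z = ip y (amul (astar x) z)) ->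
  forall r s t : tensor A B, ip (amul r s) t = ip s (amul (astar r) t).
Proof.
move=> iA iB r s t; elim/tensor_ind: r => [|r r' ih ih'|x y].
- by rewrite astar0 !linear0l linear0r.
- by rewrite linearDl /= ipDl astarD linearDl /= ipDr ih ih'.
elim/tensor_ind: s => [|s s' ih ih'|x' y'].
- by rewrite linear0r !linear0l.
- by rewrite linearDr /= !ipDl ih ih'.
elim/tensor_ind: t => [|t t' ih ih'|x2 y2].
- by rewrite !linear0r.
- by rewrite ipDr linearDr /= ipDr ih ih'.
by rewrite astar_ptensor !amul_ptensor !ip_ptensor iA iB.
Qed.

Lemma tensor_ip_astar :
  (forall x y : A, ip x y = ip (astar y) (astar x)) ->
  (forall x y : B, ip x y = ip (astar y) (astar x)) ->
  forall s t : tensor A B, ip s t = ip (astar t) (astar s).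
Proof.
move=> iA iB s t; elim/tensor_ind: s => [|s s' ih ih'|x y].
- by rewrite astar0 linear0l linear0r.
- by rewrite astarD ipDl ipDr ih ih'.
elim/tensor_ind: t => [|t t' ih ih'|x' y'].
- by rewrite astar0 linear0l linear0r.
- by rewrite astarD ipDl ipDr ih ih'.
by rewrite !astar_ptensor !ip_ptensor iA iB.
Qed.

Lemma tensor_amul_unit (e : A) (e' : B) :
  (forall x, amul e x = x /\ amul x e = x) ->
  (forall y, amul e' y = y /\ amul y e' = y) ->
  forall t : tensor A B, amul (e ⊗ e') t = t /\ amul t (e ⊗ e') = t.
Proof.
move=> eE eE'; elim/tensor_ind => [|s t [s1 s2] [t1 t2]|x y].
- by rewrite linear0r linear0l.
- by rewrite linearDr linearDl /= s1 s2 t1 t2.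
by rewrite !amul_ptensor (eE x).1 (eE x).2 (eE' y).1 (eE' y).2.
Qed.

End TensorStarAlgebra.

(** With a left unit e, every z is the product e z. *)
Lemma unital_amul_total (C : numClosedFieldType) (A : preHilbertStarAlgType C) (e : A) :
  (forall x, amul e x = x) -> total_set [set z : A | exists x y, z = amul x y].
Proof.
move=> eE O [x Ox] _; exists x; split=> //.
exists 1%N, (fun=> 1), (fun=> x); split=> [_|]; first by exists e, x; rewrite eE.
by rewrite big_ord1 scale1r.
Qed.

(** * Tensor products of unital Hilbert quasi *-algebras *)

Theorem theorem3p5 (R : realType)
    (A0 B0 : preHilbertStarAlgType R[i]) (H1 H2 : hilbertType R[i])
    (D1 : quasi_star_data A0 H1) (D2 : quasi_star_data B0 H2)
    (D1_uhqsa : is_unital_hilbert_quasi_star_algebra D1)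
    (D2_uhqsa : is_unital_hilbert_quasi_star_algebra D2)
    (K : hilbertType R[i]) (j : {linear tensor H1 H2 -> K})
    (j_completion : is_completion j) :
  (forall (K0 : hilbertType R[i]) (j0 : {linear tensor A0 B0 -> K0}),
     is_completion j0 ->
     exists Phi : {linear K0 -> K},
       [/\ bijective Phi,
           forall a b, ip (Phi a) (Phi b) = ip a b
         & forall t, Phi (j0 t) = j (tensor_map (qemb D1) (qemb D2) t)])
  /\
  exists D : quasi_star_data (tensor A0 B0) K,
    [/\ is_unital_hilbert_quasi_star_algebra D,
        forall t, qemb D t = j (tensor_map (qemb D1) (qemb D2) t),
        forall x y xi eta,
          lact D (x ⊗ y) (j (xi ⊗ eta)) = j (lact D1 x xi ⊗ lact D2 y eta),
        forall x y xi eta,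
          ract D (j (xi ⊗ eta)) (x ⊗ y) = j (ract D1 xi x ⊗ ract D2 eta y)
      & forall xi eta,
          qstar D (j (xi ⊗ eta)) = j (qstar D1 xi ⊗ qstar D2 eta)].
Proof.
have [hD1 /(is_unitalP hD1) [e1 e1P]] := D1_uhqsa.
have [hD2 /(is_unitalP hD2) [e2 e2P]] := D2_uhqsa.
have [q1i q1d] := qemb_completion hD1; have [q2i q2d] := qemb_completion hD2.
have [ji jd] := j_completion.
pose i : {linear tensor A0 B0 -> K} := j \o tensor_map (qemb D1) (qemb D2).
have jc : continuous j.
  apply: (bounded_semilinear_continuous (linear_semilinear j)).
  exact: isometry_bounded_map (isometry_norm ji).
have ic : is_completion i.
  split=> [s t|]; first by rewrite ji tensor_map_isometry.
  apply/dense_rangeP => k e e0; have e2' : 0 < e / 2 by exact: divr_gt0.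
  have [t kt] := (dense_rangeP j).1 jd k _ e2'.
  have [s ts] := (dense_rangeP _).1 (tensor_map_dense q1d q2d) t _ e2'.
  exists s; rewrite -(subrKA (j t)) [e]splitr.
  apply: le_lt_trans (ler_normD _ _) (ltrD kt _).
  by rewrite -linearB /= (isometry_norm ji).
split=> [K0 j0 j0c|]; first exact: completion_unique j0c ic.
have eP := tensor_amul_unit e1P e2P.
have [||||D [Di hD]] := completion_quasi_star _ _ _ _ ic.
- exact: tensor_amul_continuous (amul_continuous hD1) (amul_continuous hD2).
- exact: tensor_ip_amul (ip_amul hD1) (ip_amul hD2).
- exact: tensor_ip_astar (ip_astar hD1) (ip_astar hD2).
- exact: unital_amul_total (fun t => (eP t).1).
have hQ := hilbert_quasi_star hD.
have hQ1 := hilbert_quasi_star hD1; have hQ2 := hilbert_quasi_star hD2.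
have comp (X Y Z : normedModType R[i]) (f : Y -> Z) (g : X -> Y) :
    continuous f -> continuous g -> continuous (f \o g).
  by move=> fc gc x; apply: continuous_comp; [exact: gc|exact: fc].
(* An operation of K that is f ⊗ g on A0 ⊗ B0 is f ⊗ g on all elementary
   tensors: first eta varies with xi in A0, then xi varies. *)
have elementary (F : K -> K) (f : H1 -> H1) (g : H2 -> H2) :
    continuous F -> continuous f -> continuous g ->
    (forall x y, F (qemb D (x ⊗ y)) = j (f (qemb D1 x) ⊗ g (qemb D2 y))) ->
  forall xi eta, F (j (xi ⊗ eta)) = j (f xi ⊗ g eta).
  move=> Fc fc gc FE xi eta; move: xi.
  apply: (dense_range_continuous_eq (f := fun xi => F (j (xi ⊗ eta)))
    (g := fun xi => j (f xi ⊗ g eta)) q1d).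
  - apply: (comp _ _ _ F) => //; apply: (comp _ _ _ j) => //.
    exact: ptensorr_continuous.
  - apply: (comp _ _ _ j) => //; apply: (comp _ _ _ (fun u => u ⊗ g eta)) => //.
    exact: ptensorr_continuous.
  move=> x; move: eta.
  apply: (dense_range_continuous_eq (f := fun eta => F (j (qemb D1 x ⊗ eta)))
    (g := fun eta => j (f (qemb D1 x) ⊗ g eta)) q2d).
  - apply: (comp _ _ _ F) => //; apply: (comp _ _ _ j) => //.
    exact: ptensorl_continuous.
  - apply: (comp _ _ _ j) => //; apply: (comp _ _ _ (fun v => f (qemb D1 x) ⊗ v)) => //.
    exact: ptensorl_continuous.
  by move=> y; rewrite -FE Di /i /= tensor_mapp.
have qE x y : qemb D (x ⊗ y) = j (qemb D1 x ⊗ qemb D2 y).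
  by rewrite Di /i /= tensor_mapp.
exists D; split.
- by split=> //; apply/(is_unitalP hD); exists (e1 ⊗ e2).
- by move=> t; rewrite Di.
- move=> x y; apply: elementary => [|||a b].
  + exact: lact_continuous.
  + exact: lact_continuous.
  + exact: lact_continuous.
  + by rewrite (lact_qemb hQ) (lact_qemb hQ1) (lact_qemb hQ2) amul_ptensor qE.
- move=> x y.
  apply: (elementary (fun k => ract D k (x ⊗ y)) (fun h => ract D1 h x)
    (fun h => ract D2 h y)) => [|||a b].
  + exact: ract_continuous.
  + exact: ract_continuous.
  + exact: ract_continuous.
  + by rewrite (ract_qemb hQ) (ract_qemb hQ1) (ract_qemb hQ2) amul_ptensor qE.
- apply: elementary => [|||a b].
  + exact: qstar_continuous.
  + exact: qstar_continuous.
  + exact: qstar_continuous.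
  + by rewrite (qstar_qemb hQ) (qstar_qemb hQ1) (qstar_qemb hQ2) astar_ptensor qE.
Qed.
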